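(* Let $\mathcal{H}$ be a class of distribution functions on $\mathbb{R}$ such that $$\int_{\mathbb{R}} x\,H\{dx\} = 0 \quad\text{and}\quad \int_{\mathbb{R}} x^2\,H\{dx\} = 1 \quad \text{for all } H \in \mathcal{H},$$ and $$\lim_{c\to\infty}\ \sup_{H\in\mathcal{H}} \int_{|x|>c} x^2\,H\{dx\} = 0.$$ Then for every $\epsilon > 0$ there exists $\delta > 0$, depending only on $\epsilon$ and $\mathcal{H}$, such that $$\sup_{z\in\mathbb{R}} |G(z;\bm{a},\Gamma,F) - \Phi(z)| \le \epsilon$$ for all $F \in \mathcal{H}$, all square summable real arrays $\bm{a} = (a_{r,s} : r,s\in\mathbb{Z})$ and all finite subsets $\Gamma \subset \mathbb{Z}^2$ for which $\sigma(\bm{a},\Gamma) > 0$ and $\rho(\bm{a},\Gamma) \le \delta$.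
   Context: Let $\bm{a} = (a_{r,s}: r,s\in\mathbb{Z}) \in \ell^2(\mathbb{Z}^2)$ be a square summable real array, and let $\xi_{r,s}$, $r,s\in\mathbb{Z}$, be i.i.d. real random variables with mean $0$, variance $1$ and common distribution function $F$. The linear random field is $$X_{j,k} = \sum_{r\in\mathbb{Z}}\sum_{s\in\mathbb{Z}} a_{r,s}\,\xi_{j-r,k-s}, \quad (j,k)\in\mathbb{Z}^2$$ (the series converging in $L^2$). For a finite set $\Gamma\subset\mathbb{Z}^2$ put $S = S(\bm{a},\Gamma) = \sum_{(j,k)\in\Gamma} X_{j,k}$ and $$b_{r,s} = b_{r,s}(\bm{a},\Gamma) = \sum_{(j,k)\in\Gamma} a_{j+r,k+s},$$ so that $S = \sum_{r,s\in\mathbb{Z}} b_{r,s}\,\xi_{-r,-s}$. Let $\sigma^2 = \sigma^2(\bm{a},\Gamma) = E(S^2) = \sum_{r,s\in\mathbb{Z}} b_{r,s}^2$, with $\sigma = \sigma(\bm{a},\Gamma) \ge 0$; it is assumed throughout that $\sigma > 0$. Define $$\rho = \rho(\bm{a},\Gamma) = \max_{r,s\in\mathbb{Z}} \frac{|b_{r,s}|}{\sigma}, \qquad G(z) = G(z;\bm{a},\Gamma,F) = P\left[\frac{S}{\sigma} \le z\right],\ z\in\mathbb{R}.$$ $\Phi$ denotes the standard normal distribution function, and $\int f(x)\,H\{dx\}$ denotes integration with respect to the probability measure with distribution function $H$. *)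

(* Defs.v *)
(* The lattice Z^2 is [int * int], with its componentwise additive group law. *)
From mathcomp Require Import all_boot all_order all_algebra finmap.
From mathcomp Require Import all_classical all_reals all_analysis.
From mathcomp Require summability.

Set Implicit Arguments.
Unset Strict Implicit.
Unset Printing Implicit Defensive.

Import Order.TTheory GRing.Theory Num.Theory.
Import numFieldNormedType.Exports.

Local Open Scope classical_set_scope.
Local Open Scope ring_scope.

Notation Z2 := (int * int)%type.

(* Distribution functions on the real line; [lebesgue_stieltjes_measure H] is
   the probability measure with distribution function [H]. *)
Notation distribution_function R := (cumulativeBounded (0 : R) (1 : R)).

Definition Phi (R : realType) (z : R) : R := fine (normal_prob 0 1 `]-oo, z]).

Section Array.
Context {R : realType}.
Implicit Types (a : Z2 -> R) (Gamma : {fset Z2}).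

Definition square_summable a : Prop :=
  summable [set: Z2] (fun p => ((a p) ^+ 2)%:E).

Definition b_coef a Gamma (p : Z2) : R := \sum_(x <- Gamma) a (x + p).

(* [sigma a Gamma ^+ 2] is the variance E(S^2) of S = \sum_(x <- Gamma) X x, since
   S = \sum_p b_coef a Gamma p * xi (- p) in L^2 with orthonormal [xi]. *)
Definition sigma a Gamma : R :=
  Num.sqrt (fine (\esum_(p in [set: Z2]) ((b_coef a Gamma p) ^+ 2)%:E)).

(* For square summable [a] with [0 < sigma a Gamma] this supremum is a
   maximum: [b_coef a Gamma] is then square summable, so it tends to 0. *)
Definition rho a Gamma : R :=
  sup (range (fun p => `|b_coef a Gamma p| / sigma a Gamma)).

End Array.

Section Field.
Context {d : measure_display} {T : measurableType d} {R : realType}.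
Variable P : probability T R.

Definition mutually_independent (I : choiceType) (xi : I -> {RV P >-> R}) : Prop :=
  forall (J : {fset I}) (B : I -> set R), (forall i, measurable (B i)) ->
    P (\bigcap_(i in [set` J]) (xi i @^-1` B i)) =
    (\prod_(i <- J) P (xi i @^-1` B i))%E.

Definition iid (I : choiceType) (xi : I -> {RV P >-> R})
    (F : distribution_function R) : Prop :=
  mutually_independent xi /\ forall i z, cdf (xi i) z = (F z)%:E.

(* [X x] is the sum in L^2 of the family [a p * xi (x - p)], p in Z^2: the
   finite partial sums converge along the finite subsets of Z^2 ordered by
   inclusion. *)
Definition linear_random_field (a : Z2 -> R) (xi X : Z2 -> {RV P >-> R}) : Prop :=
  forall x : Z2,
    Lnorm P 2%:E (fun w => (X x w - \sum_(p <- A) a p * xi (x - p) w)%:E)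
      @[A --> summability.totally] --> 0%E.

Definition G (X : Z2 -> {RV P >-> R}) (a : Z2 -> R) (Gamma : {fset Z2}) (z : R) : R :=
  fine (P [set w | (\sum_(x <- Gamma) X x w) / sigma a Gamma <= z]).

End Field.

(* Main.v *)
Require Import Defs.
From HB Require Import structures.
From mathcomp Require Import all_boot all_order all_algebra finmap.
From mathcomp Require Import all_classical all_reals all_analysis.
From mathcomp Require Import measurable_realfun ring lra.
From mathcomp Require summability.

Set Implicit Arguments.
Unset Strict Implicit.
Unset Printing Implicit Defensive.

Import Order.TTheory GRing.Theory Num.Theory.
Import numFieldNormedType.Exports.

Local Open Scope classical_set_scope.
Local Open Scope ring_scope.

(** The proof is Stein's method, which compares the law of the normalized sum
    with the Gaussian law through a differential equation, so that no Gaussian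
    variable has to be constructed.

    For a bounded test function [h] with derivative bounded by [L], the
    equation [df t - t * f t = h t - gauss_mean h] has a solution whose
    derivative [df] is bounded and Lipschitz with a constant [M] that depends
    on [L] only ([stein_equation]). Hence [E[h V] - gauss_mean h] equals
    [E[df V - V * f V]] for every random variable [V]. If [V] is a finite sum
    of independent terms [c i * xi i], then each [E[c i * xi i * f V]] is
    expanded around the sum of the other terms, which is independent of
    [xi i]; the first-order terms add up to [E[df V]] because [xi i] is
    centred and the [c i ^+ 2] add up to about [1]. The remainders are
    controlled as in Lindeberg's theorem: beyond a level [trunc] by the tail of
    the second moment, and below it by [delta * trunc], where [delta] bounds
    all the [`|c i|] ([stein_sum]). Both bounds are uniform over the class of
    distributions, which gives the uniformity of the theorem.

    The sum over [Gamma] of the linear field is not a finite sum of innovations,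
    but it is approximated in mean square by the finite sums of the
    [b_coef a Gamma q * xi (- q)], and at the same time the squares of the
    normalized coefficients sum to almost [1] ([sum_field_approx],
    [sum_sqr_normalized_b_coef_near]). As [h] is Lipschitz, both errors
    disappear in the limit ([linear_field_smooth_clt]).

    Finally the distribution functions are compared by taking for [h] a steep
    logistic function centred next to the point [z]. All the translates of one
    logistic function share the same [L], so the bound is uniform in [z]
    ([kolmogorov_from_logistic]). *)


(** * Stein's equation for the standard normal distribution *)

Section StdNormal.
Context {R : realType}.
Implicit Types (x : R).

Definition phi : R -> R := normal_pdf 0 1.

Lemma phiE x : phi x = normal_peak 1 * expR (- (x ^+ 2 / 2)).
Proof.
rewrite /phi normal_pdfE ?oner_neq0// /normal_fun subr0 expr1n.
by rewrite mulNr.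
Qed.

Lemma phi_gt0 x : 0 < phi x.
Proof. by rewrite phiE mulr_gt0 ?expR_gt0// normal_peak_gt0 ?oner_neq0. Qed.

Lemma phi_le1 x : phi x <= 1.
Proof.
apply: (le_trans (normal_pdf_ub 0 x (oner_neq0 R))).
have pi2 := @pi_ge2 R.
have s1 : 1 <= Num.sqrt (1 ^+ 2 * pi *+ 2) :> R.
  by rewrite -[leLHS]sqrtr1 ler_sqrt expr1n; lra.
by rewrite /normal_peak invf_le1// (lt_le_trans ltr01).
Qed.

Lemma is_derive_phi x : is_derive x 1 phi (- x * phi x).
Proof.
rewrite phiE (_ : phi = fun x => normal_peak 1 * expR (- (x ^+ 2 / 2))); last first.
  by apply/funext => y; rewrite phiE.
apply: is_derive_eq; rewrite /GRing.scale /=.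
by field.
Qed.

Lemma continuous_phi : continuous phi.
Proof. exact: continuous_normal_pdf (oner_neq0 R). Qed.

(** A crude form of the decay of [phi], from [expR y >= 1 + y]. *)
Lemma phi_mulr_le1 x : `|x| * phi x <= 1.
Proof.
rewrite phiE.
have p1 : normal_peak 1 <= 1 :> R.
  by apply: le_trans (phi_le1 0); rewrite phiE expr0n/= mul0r oppr0 expR0 mulr1.
apply: (@le_trans _ _ (`|x| * expR (- (x ^+ 2 / 2)))).
  by rewrite ler_wpM2l// ler_piMl ?expR_ge0.
rewrite expRN ler_pdivrMr ?expR_gt0// mul1r.
apply: le_trans (expR_ge1Dx _).
rewrite -(real_normK (num_real x)); set y := `|x|.
have := sqr_ge0 (y - 1); lra.
Qed.

Lemma phi_antitone x y : `|x| <= y -> phi y <= phi x.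
Proof.
move=> xy; rewrite !phiE ler_wpM2l ?normal_peak_ge0// ler_expR lerN2.
rewrite ler_wpM2r ?invr_ge0// -(real_normK (num_real x)).
by rewrite lerXn2r ?nnegrE// (le_trans _ xy).
Qed.

Lemma cvg_phiy : phi x @[x --> +oo] --> 0.
Proof.
apply/cvgrPdist_le => /= e e0; near=> t.
rewrite sub0r normrN gtr0_norm ?phi_gt0//.
have t0 : 0 < t by near: t; exact: nbhs_pinfty_gt.
have := phi_mulr_le1 t; rewrite gtr0_norm// mulrC -ler_pdivlMr// mul1r.
move=> /le_trans; apply.
rewrite -[leRHS]invrK lef_pV2 ?posrE ?invr_gt0//.
Unshelve. all: by end_near. Qed.

Lemma cvg_phiNy : phi x @[x --> -oo] --> 0.
Proof.
rewrite cvgNy_compNP (_ : _ \o _ = phi); first exact: cvg_phiy.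
by apply/funext => x /=; rewrite !phiE sqrrN.
Qed.


(** If [v' = k * phi] with [`|k| <= K] and [v] vanishes at [+oo] and [-oo],
    then [v] decays like the Gaussian tail: for fixed [x > 0], the function
    [K * phi t - x * v t] is nonincreasing on [t >= x] because
    [(K * phi)' = - t * K * phi], and it tends to [0]. For [x < 0] it is
    nondecreasing on [t <= x]. *)
Lemma gaussian_tail_le (v k : R -> R) (K : R) :
  (forall t : R, is_derive t 1 v (k t * phi t)) -> (forall t, `|k t| <= K) ->
  v t @[t --> +oo] --> 0 -> v t @[t --> -oo] --> 0 ->
  forall x, x * v x <= K * phi x.
Proof.
move=> dv kK vy vNy x.
have K0 : 0 <= K by exact: le_trans (kK 0).
pose w t := K * phi t - x * v t.
have dw (t : R) : is_derive t 1 w (- (K * t + x * k t) * phi t).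
  have := dv t; have := is_derive_phi t => dp dvt.
  by apply: is_derive_eq; rewrite /GRing.scale/=; ring.
have cw A : {within A, continuous w}.
  apply: continuous_subspaceT => t.
  by apply: differentiable_continuous; apply/derivable1_diffP; case: (dw t).
have w_lim (F : set_system R) : Filter F -> phi t @[t --> F] --> (0:R) ->
    v t @[t --> F] --> 0 -> w t @[t --> F] --> 0.
  move=> FF Fp Fv.
  rewrite -[X in _ --> X](_ : K * 0 - x * 0 = 0); last by rewrite !mulr0 subr0.
  by apply: cvgB; apply: cvgMr.
suff : 0 <= w x by rewrite /w subr_ge0.
have [x0|x0|x0] := ltgtP x 0; last first.
- by rewrite /w x0 mul0r subr0 mulr_ge0// ltW// phi_gt0.
- apply: (cvgr_to_le (w_lim _ _ (cvg_phiy) vy)).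
  near=> t; apply: (@ler0_derive1_nincry _ w x) => //.
  + move=> y; rewrite in_itv/= andbT => xy; rewrite derive1E derive_val.
    rewrite mulNr oppr_le0 mulr_ge0 ?(ltW (phi_gt0 _))//.
    have := kK y; rewrite ler_norml => /andP[ky _].
    have : - (x * K) <= x * k y by rewrite -mulrN ler_wpM2l// ltW.
    have : x * K <= K * y by rewrite mulrC ler_wpM2l// ltW.
    by lra.
- apply: (cvgr_to_le (w_lim _ _ (cvg_phiNy) vNy)).
  near=> t; apply: (@ger0_derive1_ndecrNy _ w x) => //.
  + move=> y; rewrite in_itv/= => yx; rewrite derive1E derive_val.
    rewrite mulr_ge0 ?(ltW (phi_gt0 _))// oppr_ge0.
    have := kK y; rewrite ler_norml => /andP[ky _].
    have : x * k y <= x * - K by rewrite ler_wnM2l// ltW.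
    have : K * y <= x * K by rewrite [leRHS]mulrC ler_wpM2l// ltW.
    by lra.
Unshelve. all: by end_near. Qed.

Lemma gaussian_tail (v k : R -> R) (K : R) :
  (forall t : R, is_derive t 1 v (k t * phi t)) -> (forall t, `|k t| <= K) ->
  v t @[t --> +oo] --> 0 -> v t @[t --> -oo] --> 0 ->
  forall x, `|x * v x| <= K * phi x.
Proof.
move=> dv kK vy vNy x; rewrite ler_norml; apply/andP; split; last first.
  exact: (gaussian_tail_le dv).
rewrite lerNl -mulrN; apply: (@gaussian_tail_le (fun t => - v t) (fun t => - k t)).
- by move=> t; have := dv t => dvt; apply: is_derive_eq; rewrite mulNr.
- by move=> t; rewrite normrN.
- by rewrite -[X in _ --> X]oppr0; apply: cvgN.
- by rewrite -[X in _ --> X]oppr0; apply: cvgN.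
Qed.


Let idR : measurableTypeR R -> R := idfun.

#[local] HB.instance Definition _ :=
  @isMeasurableFun.Build _ _ _ _ idR (@measurable_id _ _ setT).

Lemma Phi_cdf z : Phi z = fine (cdf (idR : {RV (normal_prob 0 1) >-> R}) z).
Proof. by rewrite /Phi /cdf /distribution /pushforward /= preimage_id. Qed.

Lemma cvg_Phiy : @Phi R z @[z --> +oo] --> (1:R).
Proof. under eq_cvg do rewrite Phi_cdf; exact/fine_cvg/cvg_cdfy1. Qed.

Lemma cvg_PhiNy : @Phi R z @[z --> -oo] --> (0:R).
Proof. under eq_cvg do rewrite Phi_cdf; exact/fine_cvg/cvg_cdfNy0. Qed.

Lemma PhiE z : Phi z = \int[lebesgue_measure]_(t in `]-oo, z]) phi t.
Proof. by []. Qed.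

Lemma integrable_phi (A : set (measurableTypeR R)) :
  measurable A ->
  lebesgue_measure.-integrable A (EFin \o phi).
Proof. by move=> mA; apply: integrableS (integrable_normal_pdf 0 1). Qed.

Lemma Rintegral_phi : \int[lebesgue_measure]_t phi t = 1.
Proof. by rewrite /Rintegral integral_normal_pdf. Qed.

Lemma integrable_Mphi (k : R -> R) (K : R) (A : set (measurableTypeR R)) :
  measurable A ->
  continuous k -> (forall t, `|k t| <= K) ->
  lebesgue_measure.-integrable A (EFin \o (fun t => k t * phi t)).
Proof.
move=> mA ck kK.
change (lebesgue_measure.-integrable A ((EFin \o k) \* (EFin \o phi))%E).
apply: integrableMr => //; last exact: integrable_phi.
- by apply: measurable_funTS; exact: continuous_measurable_fun.
- exists K; split; first exact: num_real.
  by move=> M KM t _; exact: (le_trans (kK t)) (ltW KM).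
Qed.

Lemma le_normr_integral_Mphi (k : R -> R) (K : R) (A : set (measurableTypeR R)) :
  measurable A ->
  continuous k -> (forall t, `|k t| <= K) ->
  `|\int[lebesgue_measure]_(t in A) (k t * phi t)| <=
    K * \int[lebesgue_measure]_(t in A) phi t.
Proof.
move=> mA ck kK; have ik := integrable_Mphi mA ck kK.
apply: (le_trans (le_normr_Rintegral mA ik)).
rewrite -RintegralZl//; last exact: integrable_phi.
apply: le_Rintegral => //.
- exact: (integrable_norm ik).
- apply: (@integrable_Mphi (fun=> K) `|K|) => //; exact: cst_continuous.
- by move=> t _; rewrite normrM (gtr0_norm (phi_gt0 t)) ler_wpM2r// ltW ?phi_gt0.
Qed.

Lemma Rintegral_halflines (f : R -> R) x :
  lebesgue_measure.-integrable [set: R] (EFin \o f) ->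
  \int[lebesgue_measure]_(t in `]-oo, x]) f t +
    \int[lebesgue_measure]_(t in `]x, +oo[) f t =
  \int[lebesgue_measure]_t f t.
Proof.
have TE : [set: R] = `]-oo, x] `|` `]x, +oo[.
  by apply/seteqP; split => t //= _; rewrite !in_itv/= andbT; case: leP; [left|right].
move=> intf; rewrite TE Rintegral_setU//=; first by rewrite -TE.
apply/disj_set2P; rewrite -subset0 => t [] /=.
by rewrite !in_itv/= andbT leNgt => /negP.
Qed.

Definition gauss_mean (h : R -> R) : R :=
  \int[lebesgue_measure]_t (h t * phi t).

(** The primitive from [-oo] of a centred density [k * phi] vanishes at both
    ends; dividing it by [phi] solves Stein's equation. *)
Lemma centred_primitive (k : R -> R) (K : R) :
  continuous k -> (forall t, `|k t| <= K) -> gauss_mean k = 0 ->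
  exists u : R -> R, [/\ forall x : R, is_derive x 1 u (k x * phi x),
    u x @[x --> +oo] --> (0:R) & u x @[x --> -oo] --> (0:R)].
Proof.
move=> ck kK k0.
pose u x := \int[lebesgue_measure]_(t in `]-oo, x]) (k t * phi t).
exists u; split.
- move=> x; have ckp : {for x, continuous (fun t => k t * phi t)}.
    by apply: cvgM; [exact: ck|exact: continuous_phi].
  have ikp := integrable_Mphi (measurable_itv `]-oo, x + 1]) ck kK.
  have xx1 : x < x + 1 by rewrite ltrDl.
  have [du du_eq] := @continuous_FTC1 R _ -oo%O x _ xx1 ikp (ltNyr x) ckp.
  by rewrite -du_eq derive1E; exact: derivableP.
- have uE x : u x = - \int[lebesgue_measure]_(t in `]x, +oo[) (k t * phi t).
    apply/eqP; rewrite -addr_eq0 -k0 Rintegral_halflines//.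
    exact: (integrable_Mphi measurableT ck kK).
  apply: norm_cvg0.
  apply: (@squeeze_cvgr _ _ _ _ (fun=> 0) (fun x => K * (1 - Phi x))).
  + near=> x; rewrite normr_ge0/= uE normrN.
    apply: le_trans (le_normr_integral_Mphi (measurable_itv _) ck kK) _.
    rewrite ler_wpM2l ?(le_trans _ (kK 0))// lerBrDl PhiE Rintegral_halflines//.
      by rewrite Rintegral_phi.
    exact: (integrable_phi measurableT).
  + exact: cvg_cst.
  + rewrite -[X in _ --> X](_ : K * (1 - 1) = 0); last by rewrite subrr mulr0.
    by apply: cvgMr; apply: cvgB; [exact: cvg_cst|exact: cvg_Phiy].
- apply: norm_cvg0.
  apply: (@squeeze_cvgr _ _ _ _ (fun=> 0) (fun x => K * Phi x)).
  + near=> x; rewrite normr_ge0/=.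
    exact: le_normr_integral_Mphi.
  + exact: cvg_cst.
  + rewrite -[X in _ --> X](mulr0 K).
    by apply: cvgMr; exact: cvg_PhiNy.
Unshelve. all: by end_near. Qed.

Lemma derive_continuous (g dg : R -> R) :
  (forall t : R, is_derive t 1 g (dg t)) -> continuous g.
Proof.
move=> dgP t; apply: differentiable_continuous; apply/derivable1_diffP.
by case: (dgP t).
Qed.

Lemma derive_bounded_lipschitz (g dg : R -> R) (M : R) :
  (forall t : R, is_derive t 1 g (dg t)) -> (forall t, `|dg t| <= M) ->
  forall x y, `|g x - g y| <= M * `|x - y|.
Proof.
move=> dgP dgM.
have base x y : x <= y -> `|g y - g x| <= M * `|y - x|.
  move=> xy.
  have cg := continuous_subspaceT (A := `[x, y]) (derive_continuous dgP).
  have [c _ ->] := MVT_segment xy (fun t _ => dgP t) cg.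
  by rewrite normrM ler_wpM2r.
move=> x y; have [xy|/ltW yx] := leP x y; last exact: base.
by rewrite distrC (distrC x); exact: base.
Qed.

(** A Taylor estimate of order one that asks only for a Lipschitz derivative,
    with the constant [M] of the mean value theorem instead of [M / 2]. *)
Lemma derive_taylor1 (f df : R -> R) (M : R) :
  (forall t : R, is_derive t 1 f (df t)) ->
  (forall s t, `|df s - df t| <= M * `|s - t|) ->
  forall x y, `|f y - f x - (y - x) * df x| <= M * `|y - x| ^+ 2.
Proof.
move=> dfP dfL x y.
have mvt a b : a <= b -> exists2 c, a <= c <= b & f b - f a = df c * (b - a).
  move=> ab; have cf := continuous_subspaceT (A := `[a, b]) (derive_continuous dfP).
  by have [c] := MVT_segment ab (fun t _ => dfP t) cf; rewrite in_itv/=; exists c.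
have [c cxy ->] : exists2 c, `|c - x| <= `|y - x| & f y - f x = df c * (y - x).
  have [xy|/ltW yx] := leP x y.
    have [c /andP[xc cy] E] := mvt _ _ xy; exists c => //.
    by rewrite !ger0_norm ?subr_ge0// lerD2r.
  have [c /andP[yc cx] E] := mvt _ _ yx; exists c.
    by rewrite !ler0_norm ?subr_le0// lerN2 lerD2r.
  by rewrite -[LHS]opprB E -mulrN opprB.
rewrite mulrC -mulrBr normrM mulrC expr2 mulrA ler_wpM2r//.
have M0 : 0 <= M.
  by have := le_trans (normr_ge0 _) (dfL 1 0); rewrite subr0 normr1 mulr1.
by rewrite (le_trans (dfL _ _))// ler_wpM2l.
Qed.

(** Stein's equation [df x - x * f x = h x - gauss_mean h] has a bounded
    solution with bounded and Lipschitz derivative, the bounds depending on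
    [h] only through a bound [L] on its derivative. The solution is
    [u / phi] with [u] the primitive of [(h - gauss_mean h) * phi], so
    [gaussian_tail] bounds [x * f x] and hence [df]. Differentiating the
    equation shows that [phi * df] is itself the primitive of [(f + dh) * phi],
    so the same lemma bounds [x * df x] and hence the second derivative. *)
Lemma stein_equation (L : R) : exists2 M : R, 0 <= M &
  forall h dh : R -> R,
    (forall t : R, is_derive t 1 h (dh t)) -> (forall t, `|h t| <= 1) ->
    (forall t, `|dh t| <= L) ->
    exists f df : R -> R,
      [/\ forall t : R, is_derive t 1 f (df t),
          forall t, `|f t| <= M,
          forall t, `|df t| <= M,
          forall s t, `|df s - df t| <= M * `|s - t| &
          forall t, df t - t * f t = h t - gauss_mean h].
Proof.
(* The bound on [f] where [`|x| < 1]: there [phi] is at least [phi 1], and the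
   primitive [u] moves by at most [4] away from its value at [1], which is at
   most [2]. *)
pose C : R := 6 / phi 1.
have C6 : 6 <= C.
  by rewrite ler_pdivlMr ?phi_gt0// -[leRHS]mulr1 ler_wpM2l// phi_le1.
have [L0|L0] := ltP L 0.
  exists 0 => // h dh _ _ /(_ 0) /(le_trans (normr_ge0 _)).
  by rewrite leNgt L0.
exists (4 + 2 * (C + L)); first lra.
move=> h dh dhP h1 dhL.
have ch := derive_continuous dhP.
pose k t := h t - gauss_mean h.
have mean1 : `|gauss_mean h| <= 1.
  have := le_normr_integral_Mphi measurableT ch h1.
  by rewrite Rintegral_phi mulr1.
have k2 t : `|k t| <= 2.
  by rewrite (le_trans (ler_normB _ _))// -[leRHS]/(1 + 1) lerD.
have ck : continuous k.
  by move=> t; apply: cvgB; [exact: ch|exact: cvg_cst].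
have k0 : gauss_mean k = 0.
  rewrite /gauss_mean /k; under eq_Rintegral do rewrite mulrBl.
  rewrite RintegralB//=.
  - rewrite RintegralZl ?Rintegral_phi ?mulr1 ?subrr//.
    exact: (integrable_phi measurableT).
  - exact: (integrable_Mphi measurableT ch h1).
  - exact: (integrable_Mphi measurableT (@cst_continuous _ _ _) (fun=> lexx _)).
have [u [du uy uNy]] := centred_primitive ck k2 k0.
have utail := gaussian_tail du k2 uy uNy.
have phi0 x : phi x != 0 :> R by rewrite gt_eqF ?phi_gt0.
pose f x := u x / phi x.
pose df x := x * f x + k x.
have uE x : u x = f x * phi x by rewrite /f divfK.
have xf x : `|x * f x| <= 2.
  by rewrite -(ler_pM2r (phi_gt0 x)) -{1}(gtr0_norm (phi_gt0 x)) -normrM -mulrA -uE.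
have fP (x : R) : is_derive x 1 f (df x).
  have dux := du x; have dpx := is_derive_phi x.
  have dVx := is_deriveV (phi0 x) dpx.
  apply: (is_derive_eq (is_deriveM dux dVx)).
  rewrite /GRing.scale/= /df uE; field.
  exact: phi0.
have fC x : `|f x| <= C.
  have [x1|x1] := leP 1 `|x|.
    apply: (@le_trans _ _ 2); last lra.
    by apply: le_trans (xf x); rewrite [leRHS]normrM ler_peMl.
  have up : `|u 1| <= 2.
    have := utail 1; rewrite mul1r => /le_trans; apply.
    by have := phi_le1 (1 : R); lra.
  have u6 : `|u x| <= 6.
    have uL := @derive_bounded_lipschitz u _ 2 du _ x 1.
    have {}uL : `|u x - u 1| <= 2 * `|x - 1|.
      apply: uL => t; rewrite normrM (gtr0_norm (phi_gt0 t)) -[leRHS]mulr1.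
      by apply: ler_pM => //; [exact/ltW/phi_gt0|exact: phi_le1].
    have := ler_normB x 1; rewrite normr1 => x2.
    have := lerB_dist (u x) (u 1); lra.
  rewrite /f /C normrM normfV (gtr0_norm (phi_gt0 x)) ler_pM//.
    by rewrite invr_ge0 ltW// phi_gt0.
  by rewrite lef_pV2 ?posrE ?phi_gt0// phi_antitone// ltW.
have df4 x : `|df x| <= 4.
  by rewrite (le_trans (ler_normD _ _))// (_ : 4 = 2 + 2) ?lerD//; lra.
have dfP (x : R) : is_derive x 1 df (f x + x * df x + dh x).
  have := dhP x; have := fP x => dfx dhx.
  have dkx : is_derive x 1 k (dh x) by apply: is_derive_eq; rewrite subr0.
  by apply: is_derive_eq; rewrite /GRing.scale/=; ring.
have xdf x : `|x * df x| <= C + L.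
  pose v x := phi x * df x.
  have vE (F : set_system R) (FF : Filter F) : phi t @[t --> F] --> (0:R) ->
      v t @[t --> F] --> (0:R).
    move=> Fp; apply: norm_cvg0.
    apply: (@squeeze_cvgr _ _ _ _ (fun=> 0) (fun t => 4 * phi t)).
    - near=> t; rewrite normr_ge0/= normrM (gtr0_norm (phi_gt0 t)) mulrC.
      by rewrite ler_wpM2r ?(ltW (phi_gt0 _)).
    - exact: cvg_cst.
    - by rewrite -[X in _ --> X](mulr0 4); apply: cvgMr.
  have vP (t : R) : is_derive t 1 v ((f t + dh t) * phi t).
    have := dfP t; have := is_derive_phi t => dpt dft.
    by apply: is_derive_eq; rewrite /GRing.scale/=; ring.
  have fdh t : `|f t + dh t| <= C + L.
    by rewrite (le_trans (ler_normD _ _))// lerD.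
  have vy : v t @[t --> +oo] --> (0:R) by apply: vE; exact: cvg_phiy.
  have vNy : v t @[t --> -oo] --> (0:R) by apply: vE; exact: cvg_phiNy.
  have := gaussian_tail vP fdh vy vNy x.
  rewrite /v mulrCA normrM (gtr0_norm (phi_gt0 x)) [leRHS]mulrC.
  by rewrite ler_pM2l ?phi_gt0.
exists f, df; split => //.
- by move=> t; apply: le_trans (fC t) _; lra.
- by move=> t; apply: le_trans (df4 t) _; lra.
- apply: (derive_bounded_lipschitz dfP) => t.
  apply: (le_trans (ler_normD _ _)).
  have := ler_normD (f t) (t * df t); have := fC t; have := xdf t.
  by have := dhL t; lra.
- by move=> t; rewrite /df /k; ring.
Unshelve. all: by end_near. Qed.

End StdNormal.

(** * Real-valued integrals under a probability *)

Section RealIntegrals.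
Context {d : measure_display} {T : measurableType d} {R : realType}.
Variable P : probability T R.
Implicit Types f g : T -> R.

Lemma bounded_integrable f (M : R) : measurable_fun setT f ->
  (forall w, `|f w| <= M) -> P.-integrable setT (EFin \o f).
Proof.
move=> mf fM; apply: measurable_bounded_integrable => //.
- exact: fin_num_fun_lty.
- exists M; split; first exact: num_real.
  by move=> N MN w _; exact: (le_trans (fM w)) (ltW MN).
Qed.

Lemma integrable_fun_add f g : P.-integrable setT (EFin \o f) ->
  P.-integrable setT (EFin \o g) ->
  P.-integrable setT (EFin \o (fun w => f w + g w)).
Proof. by move=> fi gi; exact: (integrableD measurableT fi gi). Qed.

Lemma integrable_fun_scale (k : R) f : P.-integrable setT (EFin \o f) ->
  P.-integrable setT (EFin \o (fun w => k * f w)).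
Proof. by move=> fi; exact: (integrableZl measurableT k fi). Qed.

Lemma integrable_fun_opp f : P.-integrable setT (EFin \o f) ->
  P.-integrable setT (EFin \o (fun w => - f w)).
Proof. by move=> fi; exact: (integrableN fi). Qed.

Lemma integrable_fun_sub f g : P.-integrable setT (EFin \o f) ->
  P.-integrable setT (EFin \o g) ->
  P.-integrable setT (EFin \o (fun w => f w - g w)).
Proof. by move=> fi gi; exact: (integrable_fun_add fi (integrable_fun_opp gi)). Qed.

Lemma integrable_fun_mul_bounded f g (M : R) : P.-integrable setT (EFin \o f) ->
  measurable_fun setT g -> (forall w, `|g w| <= M) ->
  P.-integrable setT (EFin \o (fun w => f w * g w)).
Proof.
move=> fi mg gM.
change (P.-integrable setT ((EFin \o f) \* (EFin \o g))%E).
apply: integrableMl => //; exists M; split; first exact: num_real.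
by move=> N MN w _; exact: (le_trans (gM w)) (ltW MN).
Qed.

Lemma integrable_fun_sum (I : Type) (s : seq I) (h : I -> T -> R) :
  (forall i, P.-integrable setT (EFin \o h i)) ->
  P.-integrable setT (EFin \o (fun w => \sum_(i <- s) h i w)).
Proof.
move=> hi; elim: s => [|i s IHs].
  under eq_fun do rewrite big_nil.
  by apply: (@bounded_integrable _ 0) => // w; rewrite normr0.
under eq_fun do rewrite big_cons.
exact: integrable_fun_add.
Qed.

Lemma Rintegral_sum (I : Type) (s : seq I) (h : I -> T -> R) :
  (forall i, P.-integrable setT (EFin \o h i)) ->
  \int[P]_w (\sum_(i <- s) h i w) = \sum_(i <- s) \int[P]_w h i w.
Proof.
move=> hi; elim: s => [|i s IHs].
  under eq_Rintegral do rewrite big_nil.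
  by rewrite Rintegral_cst// mul0r big_nil.
under eq_Rintegral do rewrite big_cons.
rewrite RintegralD// ?IHs ?big_cons//.
exact: integrable_fun_sum.
Qed.

Lemma Rintegral_probability_cst (k : R) : \int[P]_w k = k.
Proof. by rewrite Rintegral_cst// [X in fine X](@probability_setT _ _ _ P) mulr1. Qed.

Lemma ler_norm_Rintegral f g : P.-integrable setT (EFin \o f) ->
  P.-integrable setT (EFin \o g) -> (forall w, `|f w| <= g w) ->
  `|\int[P]_w f w| <= \int[P]_w g w.
Proof.
move=> fi gi fg; apply: (le_trans (le_normr_Rintegral measurableT fi)).
by apply: le_Rintegral => //; exact: integrable_norm.
Qed.

End RealIntegrals.

(** * Independence *)

Section Independence.
Context {d : measure_display} {T : measurableType d} {R : realType}.
Variable P : probability T R.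

Definition independent2 (X Y : T -> R) : Prop :=
  forall A B : set R, measurable A -> measurable B ->
    P (X @^-1` A `&` Y @^-1` B) = (P (X @^-1` A) * P (Y @^-1` B))%E.

(** Independence says that the joint law and the product of the laws agree on
    rectangles, which determine a product measure. *)
Lemma independent2_product (X Y : {RV P >-> R}) (C : set (R * R)) :
  independent2 X Y -> measurable C ->
  (distribution P X \x distribution P Y)%E C =
    pushforward P (fun w => (X w, Y w)) C.
Proof.
move=> indep mC.
have mXY : measurable_fun setT (fun w => (X w, Y w)) by exact: measurable_fun_pair.
pose Z : {mfun T >-> (R * R)%type} := mfun_Sub (mem_set mXY).
have -> : pushforward P (fun w => (X w, Y w)) C = distribution P Z C by [].
apply: product_measure_unique => // A B mA mB.
Qed.

(** Fubini's theorem for the joint law of an independent pair. The factor [p X]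
    need not be bounded, since it is applied to [xi i] and to its square. *)
Lemma independent2_Rintegral (X Y : {RV P >-> R}) (p g : R -> R) (M : R) :
  independent2 X Y -> measurable_fun setT p -> measurable_fun setT g ->
  P.-integrable setT (EFin \o (fun w => p (X w))) -> (forall y, `|g y| <= M) ->
  \int[P]_w (p (X w) * g (Y w)) = \int[P]_w p (X w) * \int[P]_w g (Y w).
Proof.
move=> indep mp mg ip gM.
have mXY : measurable_fun setT (fun w => (X w, Y w)) by exact: measurable_fun_pair.
pose f (z : R * R) := p z.1 * g z.2.
have mf : measurable_fun [set: (R * R)%type] (EFin \o f).
  apply/measurable_EFinP; apply: measurable_funM.
  - exact: measurableT_comp mp measurable_fst.
  - exact: measurableT_comp mg measurable_snd.
have ipg : P.-integrable setT ((EFin \o f) \o (fun w => (X w, Y w))).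
  by apply: (integrable_fun_mul_bounded ip _ (fun w => gM (Y w)));
    exact: measurableT_comp mg _.
have igY : P.-integrable setT (EFin \o (fun w => g (Y w))).
  apply: (@bounded_integrable _ _ _ _ _ M) => [|w]; last exact: gM.
  exact: measurableT_comp mg _.
have eqm (h : R * R -> \bar R) :
    (\int[(distribution P X \x distribution P Y)%E]_z h z =
     \int[pushforward P (fun w => (X w, Y w))]_z h z)%E.
  apply: eq_measure_integral => C mC _.
  exact: independent2_product.
have iprod : (distribution P X \x distribution P Y)%E.-integrable setT (EFin \o f).
  apply/integrableP; split => //; rewrite eqm.
  by have /integrableP[_] := integrable_pushforward mXY mf ipg measurableT.
rewrite /Rintegral -fineM.
- congr fine.
  have -> : (\int[P]_w (p (X w) * g (Y w))%:E =
      \int[(distribution P X \x distribution P Y)%E]_z (f z)%:E)%E.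
    by rewrite eqm integral_pushforward.
  rewrite -integral12_prod_meas1//.
  rewrite -(@integral_distribution _ _ _ _ _ _ Y (EFin \o g))//;
    last exact/measurable_EFinP.
  rewrite -(@integral_distribution _ _ _ _ _ _ X (EFin \o p))//;
    last exact/measurable_EFinP.
  have iX : (distribution P X).-integrable setT (EFin \o p).
    by apply: integrable_pushforward => //; exact/measurable_EFinP.
  have iY : (distribution P Y).-integrable setT (EFin \o g).
    by apply: integrable_pushforward => //; exact/measurable_EFinP.
  have fY := integrable_fin_num measurableT iY.
  rewrite -(fineK fY) -integralZr//; apply: eq_integral => x _.
  by rewrite fineK// -integralZl.
- exact: (integrable_fin_num measurableT ip).
- exact: (integrable_fin_num measurableT igY).
Qed.

(** Grouping. Mutual independence speaks of cylinders, which are stable under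
    intersection, so two finite measures that agree on cylinders over [J] agree
    on the sigma-algebra they generate; the weighted sum over [J] is measurable
    for it. The measures compared are [P] restricted to an event of [xi i], and
    [P] scaled by the probability of that event. *)
Lemma mutually_independent_sum (I : choiceType) (xi : I -> {RV P >-> R})
    (J : {fset I}) (i : I) (c : I -> R) :
  mutually_independent xi -> i \notin J ->
  independent2 (xi i) (fun w => \sum_(j <- J) c j * xi j w).
Proof.
move=> indep iJ A B mA mB.
pose cyl (D : I -> set R) := \bigcap_(j in [set` J]) (xi j @^-1` D j).
pose G : set (set T) := [set E | exists2 D : I -> set R,
  (forall j, measurable (D j)) & E = cyl D].
have mxi j (D : set R) : measurable D -> measurable (xi j @^-1` D).
  by move=> mD; exact: measurable_funPTI.
have Gm : G `<=` measurable.
  move=> _ [D mD ->]; apply: fin_bigcap_measurable => // j _.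
  exact: mxi.
have cylT : cyl (fun=> setT) = setT.
  by apply/seteqP; split.
have GT : G setT by exists (fun=> setT).
have GI : setI_closed G.
  move=> _ _ [D mD ->] [D' mD' ->].
  exists (fun j => D j `&` D' j); first by move=> j; exact: measurableI.
  by rewrite /cyl -bigcapI.
have mA' := mxi i A mA.
pose m1 := mrestr P mA'.
pose m2 := mscale (NngNum (fine_ge0 (measure_ge0 P (xi i @^-1` A)))) P.
have fA : P (xi i @^-1` A) \is a fin_num by exact: fin_num_measure.
have m12 E : G E -> m1 E = m2 E.
  move=> [D mD ->]; rewrite /m1 /m2 /mrestr /mscale/= fineK//.
  pose D' j := if j == i then A else D j.
  have mD' j : measurable (D' j) by rewrite /D'; case: ifP.
  have D'J j : j \in J -> D' j = D j.
    by move=> jJ; rewrite /D'; case: eqP => // ji; rewrite -ji jJ in iJ.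
  have := indep (i |` J)%fset D' mD'.
  have D'i : D' i = A by rewrite /D' eqxx.
  rewrite bigcap_fsetU1 big_fsetU1//= D'i setIC.
  rewrite [X in P (X `&` _)](_ : _ = cyl D); last first.
    by apply: eq_bigcapr => j jJ; rewrite D'J.
  move=> ->; congr (_ * _)%E; rewrite (indep J D mD).
  by apply: eq_big_seq => j jJ; rewrite D'J.
pose Y w := \sum_(j <- J) c j * xi j w.
have mY : measurable_fun [set: g_sigma_algebraType G] (Y : g_sigma_algebraType G -> R).
  (* Only the [xi j] with [j] in [J] are measurable for the cylinders over [J]. *)
  pose h j w := c j * (if j \in J then xi j w else 0).
  rewrite (_ : Y = fun w => \sum_(j <- J) h j w); last first.
    by apply/funext => w; apply: eq_big_seq => j jJ; rewrite /h jJ.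
  apply: measurable_sum => j; apply: measurable_funM => //.
  have [jJ|jJ] := boolP (j \in J); last exact: measurable_cst.
  move=> _ D mD; rewrite setTI; apply: sub_sigma_algebra.
  exists (fun k => if k == j then D else setT).
    by move=> k; case: ifP.
  apply/seteqP; split => w.
    by move=> Dw k /= kJ; case: eqP => // ->.
  by move=> /(_ j jJ) /=; rewrite eqxx.
have GY : <<s G >> (Y @^-1` B).
  by have := mY measurableT B mB; rewrite setTI.
have : m1 (Y @^-1` B) = m2 (Y @^-1` B).
  apply: (g_sigma_algebra_measure_unique G Gm (fun=> setT)) => //.
  - by rewrite bigcup_const//; exists 0%N.
  - by move=> k; exact: fin_num_fun_lty.
by rewrite /m1 /m2 /mrestr /mscale/= fineK// setIC.
Qed.

End Independence.

(** * Moments determined by the distribution function *)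

Section Law.
Context {d : measure_display} {T : measurableType d} {R : realType}.
Variable P : probability T R.

Variables (F : distribution_function R) (X : {RV P >-> R}).
Hypothesis cdfX : forall z, cdf X z = (F z)%:E.

(* [X] with values in the copy of [R] that carries the Stieltjes measures. *)
Let X' : T -> measurableTypeR R := X.

Let mX' : measurable_fun setT X'.
Proof. exact: (@measurable_funPT _ _ _ _ X). Qed.

#[local] HB.instance Definition _ := @isMeasurableFun.Build _ _ _ _ X' mX'.

Lemma law_lebesgue_stieltjes (A : set (measurableTypeR R)) : measurable A ->
  lebesgue_stieltjes_measure F A = distribution P (X' : {mfun T >-> measurableTypeR R}) A.
Proof.
apply: lebesgue_stieltjes_measure_unique => I [[a b]] /= _ <-.
rewrite /lebesgue_stieltjes_measure /measure_extension/=.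
rewrite measurable_mu_extE/=; last exact: is_ocitv.
have [ab|ba] := leP a b; last first.
  by rewrite set_itv_ge ?wlength0 ?measure0// bnd_simp -leNgt ltW.
rewrite wlength_itv_bnd// EFinB -!cdfX.
have -> : `]a, b]%classic = `]-oo, b] `\` `]-oo, a] :> set (measurableTypeR R).
  by rewrite -[RHS]setCK setCD setCitvl setUC -[LHS]setCK setCitv.
rewrite measureD ?setIidr//; first exact: subset_itvl.
by rewrite -ge0_fin_numE// fin_num_measure.
Qed.

Lemma ge0_integral_law (D : set (measurableTypeR R))
    (f : measurableTypeR R -> \bar R) :
  measurable D -> measurable_fun D f -> (forall x, 0 <= f x)%E ->
  (\int[P]_(w in X @^-1` D) f (X w) =
   \int[lebesgue_stieltjes_measure F]_(x in D) f x)%E.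
Proof.
move=> mD mf f0.
rewrite (@eq_measure_integral _ _ _ _
  (distribution P (X' : {mfun T >-> measurableTypeR R}))); last first.
  by move=> A mA _; exact: law_lebesgue_stieltjes.
by rewrite /distribution ge0_integral_pushforward.
Qed.

Hypothesis var1 : (\int[lebesgue_stieltjes_measure F]_x (x ^+ 2)%:E = 1)%E.

Lemma integrable_law_sqr : P.-integrable setT (EFin \o (fun w => X w ^+ 2)).
Proof.
apply/integrableP; split.
  by apply/measurable_EFinP; apply: measurable_funX; exact: measurable_funPT.
under eq_integral do rewrite /= ger0_norm ?sqr_ge0//.
have := @ge0_integral_law setT (fun x => (x ^+ 2)%:E) measurableT.
rewrite preimage_setT var1 => -> //.
- exact: ltry.
- by apply/measurable_EFinP; exact: measurable_funX.
- by move=> x; rewrite lee_fin sqr_ge0.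
Qed.

Lemma Rintegral_law_sqr : \int[P]_w (X w ^+ 2) = 1.
Proof.
rewrite /Rintegral.
have := @ge0_integral_law setT (fun x => (x ^+ 2)%:E) measurableT.
rewrite preimage_setT var1 => -> //.
- by apply/measurable_EFinP; exact: measurable_funX.
- by move=> x; rewrite lee_fin sqr_ge0.
Qed.

Lemma integrable_law_id : P.-integrable setT (EFin \o X).
Proof.
have i1 : P.-integrable setT (EFin \o (fun w => 1 + X w ^+ 2)).
  have i1 : P.-integrable setT (EFin \o (fun=> 1)).
    by apply: (@bounded_integrable _ _ _ _ _ 1) => // w; rewrite normr1.
  exact: (integrableD measurableT i1 integrable_law_sqr).
apply: le_integrable i1 => //.
  by apply/measurable_EFinP; exact: measurable_funPT.
move=> w _ /=; rewrite lee_fin [leRHS]ger0_norm; last first.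
  by rewrite addr_ge0 ?sqr_ge0.
rewrite -(real_normK (num_real (X w))); set y := `|X w|.
have := sqr_ge0 (y - 1); have := sqr_ge0 y; lra.
Qed.

Lemma Rintegral_law_id :
  (\int[lebesgue_stieltjes_measure F]_x x%:E = 0)%E -> \int[P]_w X w = 0.
Proof.
move=> mean0.
rewrite (@eq_measure_integral _ _ _ _
  (distribution P (X' : {mfun T >-> measurableTypeR R}))) in mean0; last first.
  by move=> A mA _; exact: law_lebesgue_stieltjes.
rewrite /distribution integral_pushforward// in mean0.
  by rewrite /Rintegral mean0.
exact: integrable_law_id.
Qed.

Lemma Rintegral_law_sqr_tail (c tau : R) :
  (\int[lebesgue_stieltjes_measure F]_(x in [set x : R | (c < `|x|)%R]) (x ^+ 2)%:E
     <= tau%:E)%E ->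
  \int[P]_w (X w ^+ 2 * (c < `|X w|)%R%:R) <= tau.
Proof.
move=> tail.
pose D : set (measurableTypeR R) := [set x : R | (c < `|x|)%R].
have mD : measurable D.
  have mnorm : measurable_fun setT (@Num.norm _ R : measurableTypeR R -> R) by [].
  have := mnorm measurableT `]c, +oo[%classic (measurable_itv _).
  rewrite setTI (_ : _ @^-1` _ = D)//.
  by apply/seteqP; split => x /=; rewrite /D/= in_itv/= andbT.
have mf : measurable_fun D (fun x : measurableTypeR R => (x ^+ 2)%:E).
  by apply: measurable_funTS; apply/measurable_EFinP; exact: measurable_funX.
have tailE : (\int[P]_w (X w ^+ 2 * (c < `|X w|)%R%:R)%:E =
    \int[lebesgue_stieltjes_measure F]_(x in D) (x ^+ 2)%:E)%E.
  rewrite -ge0_integral_law//; last by move=> x; rewrite lee_fin sqr_ge0.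
  rewrite [RHS]integral_mkcond; apply: eq_integral => w _.
  rewrite patchE; have [Dw|/negP nDw] := boolP (c < `|X w|).
    by rewrite mem_set// mulr1.
  by rewrite memNset// mulr0.
rewrite /Rintegral -lee_fin tailE fineK//.
rewrite ge0_fin_numE; first exact: le_lt_trans tail (ltry _).
by apply: integral_ge0 => x _; rewrite lee_fin sqr_ge0.
Qed.
End Law.

(** * Stein's bound for weighted sums *)

Section SteinSum.
Context {d : measure_display} {T : measurableType d} {R : realType}.
Variables (P : probability T R) (I : choiceType) (xi : I -> {RV P >-> R}).
Variable F : distribution_function R.
Hypothesis xi_iid : iid xi F.
Hypothesis mean0 : (\int[lebesgue_stieltjes_measure F]_x x%:E = 0)%E.
Hypothesis var1 : (\int[lebesgue_stieltjes_measure F]_x (x ^+ 2)%:E = 1)%E.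
Variables (trunc tau : R).
Hypothesis trunc0 : 0 <= trunc.
Hypothesis tail :
  (\int[lebesgue_stieltjes_measure F]_(x in [set x : R | (trunc < `|x|)%R])
     (x ^+ 2)%:E <= tau%:E)%E.
Variables (J : {fset I}) (c : I -> R) (delta : R).
Hypothesis cdelta : forall i, i \in J -> `|c i| <= delta.
Variables (f df : R -> R) (M : R).
Hypothesis fP : forall t : R, is_derive t 1 f (df t).
Hypothesis fM : forall t, `|f t| <= M.
Hypothesis dfM : forall t, `|df t| <= M.
Hypothesis dfL : forall s t, `|df s - df t| <= M * `|s - t|.

Let V w := \sum_(j <- J) c j * xi j w.

Let mxi i : measurable_fun setT (xi i : T -> R).
Proof. exact: measurable_funPT. Qed.

Let mV : measurable_fun setT V.
Proof. by apply: measurable_sum => j; exact: measurable_funM. Qed.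

Let mf : measurable_fun setT f.
Proof.
apply: continuous_measurable_fun; exact: derive_continuous fP.
Qed.

Let M0 : 0 <= M. Proof. exact: le_trans (fM 0). Qed.

Let mdf : measurable_fun setT df.
Proof.
apply: continuous_measurable_fun => t; apply/cvgrPdist_le => /= e e0.
have M1 : 0 < M + 1 by rewrite ltr_wpDl.
near=> s; rewrite (le_trans (dfL _ _))//.
apply: (@le_trans _ _ ((M + 1) * `|t - s|)); first by rewrite ler_wpM2r// lerDl.
rewrite -ler_pdivlMl// mulrC.
near: s; apply: cvgr_dist_le; rewrite ?divr_gt0//; exact: cvg_id.
Unshelve. all: by end_near. Qed.

(** One summand of [E[V * f V]]. Writing [V = U + c i * xi i] with [U]
    independent of [xi i], the first-order expansion of [f] at [U] has
    expectation [0 + c i ^+ 2 * E[df U]]; its remainder is controlled by the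
    second moment of [xi i] beyond [trunc], where it is at most linear, and by
    [delta * trunc] below, where it is quadratic. *)
Lemma stein_summand i : i \in J ->
  `|\int[P]_w (c i * xi i w * f (V w)) - c i ^+ 2 * \int[P]_w df (V w)| <=
    c i ^+ 2 * (M * (2 * tau + delta * trunc + delta)).
Proof.
move=> iJ.
have [indep cdfF] := xi_iid.
pose X := xi i.
have iX2 := integrable_law_sqr (cdfF i) var1; rewrite -/X in iX2.
have iX := integrable_law_id (cdfF i) var1; rewrite -/X in iX.
have EX := Rintegral_law_id (cdfF i) var1 mean0; rewrite -/X in EX.
have EX2 := Rintegral_law_sqr (cdfF i) var1; rewrite -/X in EX2.
have Etail := Rintegral_law_sqr_tail (cdfF i) tail; rewrite -/X in Etail.
pose U w := \sum_(j <- (J `\ i)%fset) c j * xi j w.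
have mU : measurable_fun setT U.
  apply: (@measurable_sum _ _ _ _ _ _ (fun j w => c j * xi j w)) => j.
  by apply: measurable_funM => //; exact: mxi.
have VE w : V w = c i * X w + U w by rewrite /V (big_fsetD1 i).
have indepU : independent2 P X U.
  by apply: mutually_independent_sum => //; rewrite !inE eqxx.
pose U' : {RV P >-> R} := mfun_Sub (mem_set mU).
have bint (g : R -> R) (Y : T -> R) : measurable_fun setT g ->
    (forall t, `|g t| <= M) -> measurable_fun setT Y ->
    P.-integrable setT (EFin \o (fun w => g (Y w))).
  move=> mg gM mY; apply: (@bounded_integrable _ _ _ _ _ M) => //.
  exact: measurableT_comp mg mY.
have E1 : \int[P]_w (X w * f (U w)) = 0.
  rewrite (@independent2_Rintegral _ _ _ P X U' id f M)//.
  by rewrite EX mul0r.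
have E2 : \int[P]_w (X w ^+ 2 * df (U w)) = \int[P]_w df (U w).
  rewrite (@independent2_Rintegral _ _ _ P X U' (fun x => x ^+ 2) df M)//.
  by rewrite EX2 mul1r.
have mX : measurable_fun setT X := mxi i.
have mind : measurable_fun setT (fun w => (trunc < `|X w|)%R%:R : R).
  rewrite (_ : (fun w => _) = \1_[set w | trunc < `|X w|]); last first.
    by apply/funext => w; rewrite indicE mem_setE.
  apply: measurable_indic.
  have mnX : measurable_fun setT (fun w => `|X w|) by exact: measurableT_comp.
  have := mnX measurableT _ (measurable_itv `]trunc, +oo[).
  rewrite setTI; congr measurable.
  by apply/seteqP; split => w /=; rewrite in_itv/= andbT.
have iXfV : P.-integrable setT (EFin \o (fun w => X w * f (V w))).
  by apply: (integrable_fun_mul_bounded iX) => //; exact: measurableT_comp mf mV.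
have iXfU : P.-integrable setT (EFin \o (fun w => X w * f (U w))).
  by apply: (integrable_fun_mul_bounded iX) => //; exact: measurableT_comp mf mU.
have iXXdfU : P.-integrable setT (EFin \o (fun w => X w ^+ 2 * df (U w))).
  by apply: (integrable_fun_mul_bounded iX2) => //; exact: measurableT_comp mdf mU.
have idfV := bint df V mdf dfM mV.
have idfU := bint df U mdf dfM mU.
have itail : P.-integrable setT (EFin \o (fun w => X w ^+ 2 * (trunc < `|X w|)%R%:R)).
  by apply: (@integrable_fun_mul_bounded _ _ _ _ _ _ 1 iX2) => // w; case: (_ < _)%R;
    rewrite ?normr1 ?normr0.
have i1 : P.-integrable setT (EFin \o (fun=> 1)).
  by apply: (@bounded_integrable _ _ _ _ _ 1) => // w; rewrite normr1.
(* The error [D] has the same expectation as the difference to be bounded. *)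
pose D w := c i * (X w * f (V w)) - c i ^+ 2 * df (V w) - c i * (X w * f (U w))
  - c i ^+ 2 * (X w ^+ 2 * df (U w) - df (U w)).
have iD : P.-integrable setT (EFin \o D).
  by do !apply: integrable_fun_sub; do ?apply: integrable_fun_scale => //;
    apply: integrable_fun_sub.
have ED : \int[P]_w D w =
    \int[P]_w (c i * xi i w * f (V w)) - c i ^+ 2 * \int[P]_w df (V w).
  rewrite /D !RintegralB//; 
    do ?[do ?apply: integrable_fun_sub; by apply: integrable_fun_scale].
  - rewrite !RintegralZl//; last exact: integrable_fun_sub.
    rewrite RintegralB// E1 E2 subrr !mulr0 !subr0; congr (_ - _).
    by rewrite -RintegralZl//; under eq_Rintegral do rewrite mulrA.
  - by apply: integrable_fun_scale; exact: integrable_fun_sub.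
pose B w := 2 * (X w ^+ 2 * (trunc < `|X w|)%R%:R) + delta * trunc * X w ^+ 2
  + delta / 2 * (1 + X w ^+ 2).
have iB : P.-integrable setT (EFin \o B).
  by do !apply: integrable_fun_add; apply: integrable_fun_scale => //;
    apply: integrable_fun_add.
have EB : \int[P]_w B w <= 2 * tau + delta * trunc + delta.
  rewrite /B !RintegralD//; 
    do ?[do ?apply: integrable_fun_add; by apply: integrable_fun_scale].
  - rewrite !RintegralZl//; last exact: integrable_fun_add.
    rewrite RintegralD// EX2 Rintegral_probability_cst; lra.
  - by apply: integrable_fun_scale; exact: integrable_fun_add.
have DB w : `|D w| <= c i ^+ 2 * M * B w.
  have ci := cdelta iJ.
  pose rem := f (V w) - f (U w) - (V w - U w) * df (U w).
  have VU : V w - U w = c i * X w by rewrite VE addrK.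
  have DE : D w = c i * X w * rem - c i ^+ 2 * (df (V w) - df (U w)).
    by rewrite /D /rem VU; ring.
  have rem_quad : `|rem| <= M * (`|c i| * `|X w|) ^+ 2.
    by rewrite -normrM -VU; exact: derive_taylor1.
  have rem_lin : `|rem| <= 2 * M * (`|c i| * `|X w|).
    apply: (le_trans (ler_normB _ _)); rewrite -normrM -VU [X in _ + X]normrM.
    have := derive_bounded_lipschitz fP dfM (V w) (U w).
    have : `|V w - U w| * `|df (U w)| <= `|V w - U w| * M by rewrite ler_wpM2l.
    by lra.
  have dfVU : `|df (V w) - df (U w)| <= M * (`|c i| * `|X w|).
    by rewrite -normrM -VU.
  have -> : c i ^+ 2 * M * B w = `|c i| ^+ 2 * M * (2 * (`|X w| ^+ 2 *
      (trunc < `|X w|)%R%:R) + delta * trunc * `|X w| ^+ 2 +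
      delta / 2 * (1 + `|X w| ^+ 2)).
    by rewrite /B !real_normK ?num_real.
  rewrite DE; apply: (le_trans (ler_normB _ _)).
  rewrite !normrM -expr2.
  set x := `|X w| in rem_quad rem_lin dfVU *.
  set a := `|c i| in ci rem_quad rem_lin dfVU *.
  have x0 : 0 <= x by exact: normr_ge0.
  have a0 : 0 <= a by exact: normr_ge0.
  have delta0 : 0 <= delta by exact: le_trans ci.
  have second : a ^+ 2 * `|df (V w) - df (U w)| <=
      a ^+ 2 * M * (delta / 2 * (1 + x ^+ 2)).
    rewrite -mulrA ler_wpM2l ?sqr_ge0//; apply: (le_trans dfVU).
    rewrite ler_wpM2l//; apply: (@le_trans _ _ (delta * x)).
      by rewrite ler_wpM2r.
    by rewrite -mulrA ler_wpM2l//; have := sqr_ge0 (x - 1); lra.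
  suff first : a * x * `|rem| <= a ^+ 2 * M * (2 * (x ^+ 2 *
      (trunc < x)%R%:R) + delta * trunc * x ^+ 2).
    by rewrite mulrDr lerD.
  have dt0 : 0 <= delta * trunc * x ^+ 2 by rewrite !mulr_ge0.
  have [tx|xt] := ltP trunc x; rewrite ?mulr1 ?mulr0.
    apply: (@le_trans _ _ (a * x * (2 * M * (a * x)))).
      by rewrite ler_wpM2l// mulr_ge0.
    have : 0 <= a ^+ 2 * M * (delta * trunc * x ^+ 2) by rewrite !mulr_ge0.
    by lra.
  rewrite add0r.
  apply: (@le_trans _ _ (a * x * (M * (a * x) ^+ 2))).
    by rewrite ler_wpM2l// mulr_ge0.
  rewrite [leLHS](_ : _ = a ^+ 2 * M * (a * x * x ^+ 2)); last ring.
  rewrite ler_wpM2l ?mulr_ge0// ler_wpM2r ?mulr_ge0//.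
  exact: ler_pM.
rewrite -ED; apply: (le_trans (ler_norm_Rintegral iD _ DB)).
  exact: integrable_fun_scale.
rewrite RintegralZl// -mulrA; apply: ler_wpM2l; first exact: sqr_ge0.
by rewrite ler_wpM2l.
Qed.

(** The variances [c i ^+ 2] only have to add up to almost [1]: the defect is
    paid for with the bound on [df]. *)
Lemma stein_sum :
  `|\int[P]_w (df (V w) - V w * f (V w))| <=
    M * (`|1 - \sum_(i <- J) c i ^+ 2| +
      (\sum_(i <- J) c i ^+ 2) * (2 * tau + delta * trunc + delta)).
Proof.
have [_ cdfF] := xi_iid.
pose h i w := c i * (xi i w * f (V w)).
have ih i : P.-integrable setT (EFin \o h i).
  apply: integrable_fun_scale; apply: (@integrable_fun_mul_bounded _ _ _ _ _ _ M) => //.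
  - exact: integrable_law_id (cdfF i) var1.
  - exact: measurableT_comp mf mV.
have idfV : P.-integrable setT (EFin \o (fun w => df (V w))).
  by apply: (@bounded_integrable _ _ _ _ _ M) => //; exact: measurableT_comp mdf mV.
have VfE w : V w * f (V w) = \sum_(i <- J) h i w.
  by rewrite /h /V mulr_suml; apply: eq_bigr => i _; rewrite mulrA.
have iVf : P.-integrable setT (EFin \o (fun w => V w * f (V w))).
  by under eq_fun do rewrite VfE; exact: integrable_fun_sum.
rewrite RintegralB//; under [X in _ - X]eq_Rintegral do rewrite VfE.
rewrite Rintegral_sum//; set m := \int[P]_w df (V w).
have mM : `|m| <= M.
  rewrite -[leRHS](Rintegral_probability_cst P).
  apply: ler_norm_Rintegral => //.
  by apply: (@bounded_integrable _ _ _ _ _ M) => // w; rewrite ger0_norm.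
have -> : m - \sum_(i <- J) \int[P]_w h i w =
    (1 - \sum_(i <- J) c i ^+ 2) * m -
    \sum_(i <- J) (\int[P]_w h i w - c i ^+ 2 * m).
  by rewrite sumrB -mulr_suml; ring.
apply: (le_trans (ler_normB _ _)); rewrite mulrDr lerD//.
  by rewrite normrM mulrC ler_wpM2r.
rewrite mulrCA mulr_suml; apply: (le_trans (ler_norm_sum _ _ _)).
rewrite big_seq [leRHS]big_seq; apply: ler_sum => i iJ.
have := stein_summand iJ; rewrite /h.
by under eq_Rintegral do rewrite -mulrA.
Qed.

End SteinSum.

(** * From logistic test functions to distribution functions *)

Section Smoothing.
Context {R : realType}.
Implicit Types (L m x eta eps : R).

Definition logistic L m x : R := (1 + expR (L * (x - m)))^-1.

Lemma is_derive_logistic L m x : is_derive x 1 (logistic L m)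
  (- (L * (1 - logistic L m x) * logistic L m x)).
Proof.
have den0 : 1 + expR (L * (x - m)) != 0 by rewrite gt_eqF// ltr_wpDr ?expR_ge0.
have dden : is_derive x 1 (fun x => 1 + expR (L * (x - m))) (L * expR (L * (x - m))).
  by apply: is_derive_eq; rewrite /GRing.scale/=; ring.
rewrite (_ : logistic L m = fun x => (1 + expR (L * (x - m)))^-1)//.
have dV := is_deriveV (f := fun x => 1 + expR (L * (x - m))) den0 dden.
apply: (is_derive_eq dV).
by rewrite /GRing.scale/= /logistic; field.
Qed.

Lemma logistic_gt0 L m x : 0 < logistic L m x.
Proof. by rewrite invr_gt0 ltr_wpDr ?expR_ge0. Qed.

Lemma logistic_lt1 L m x : logistic L m x < 1.
Proof. by rewrite invf_lt1 ?ltrDl ?expR_gt0// ltr_wpDr ?expR_ge0. Qed.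

Lemma logistic_norm_le1 L m x : `|logistic L m x| <= 1.
Proof. by rewrite gtr0_norm ?logistic_gt0// ltW// logistic_lt1. Qed.

Lemma derive_logistic_le L m x : 0 <= L ->
  `|- (L * (1 - logistic L m x) * logistic L m x)| <= L.
Proof.
move=> L0; have := logistic_gt0 L m x; have := logistic_lt1 L m x.
set h := logistic L m x => h1 h0.
rewrite normrN ger0_norm ?mulr_ge0 ?subr_ge0//; try exact: ltW.
rewrite -mulrA ler_piMr// -[leRHS]mul1r; apply: ler_pM => //; lra.
Qed.

Lemma logistic_le L m eta x : 0 <= L -> m + eta <= x ->
  logistic L m x <= expR (- (L * eta)).
Proof.
move=> L0 mx; rewrite expRN lef_pV2 ?posrE ?expR_gt0 ?ltr_wpDr ?expR_ge0//.
rewrite ler_wpDl// ler_expR ler_wpM2l//; lra.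
Qed.

Lemma logistic_ge L m eta x : 0 <= L -> x <= m - eta ->
  1 - expR (- (L * eta)) <= logistic L m x.
Proof.
move=> L0 xm; set e := expR (L * (x - m)).
have e0 : 0 < e by exact: expR_gt0.
have -> : logistic L m x = 1 - e / (1 + e) by rewrite /logistic -/e; field; lra.
have ee : e <= expR (- (L * eta)).
  by rewrite ler_expR -mulrN ler_wpM2l//; lra.
rewrite lerD2l lerN2; apply: le_trans ee; rewrite ler_pdivrMr; last lra.
by rewrite mulrDr mulr1 lerDl mulr_ge0// ltW.
Qed.

Lemma is_derive_Phi x : is_derive x 1 (@Phi R) (phi x).
Proof.
have xx1 : x < x + 1 by rewrite ltrDl.
have iphi := integrable_phi (measurable_itv `]-oo, x + 1]).
have [du du_eq] :=
  @continuous_FTC1 R phi -oo%O x _ xx1 iphi (ltNyr x) (@continuous_phi R x).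
by rewrite -du_eq derive1E; exact: derivableP.
Qed.

Lemma Phi_lipschitz x y : x <= y -> Phi y - Phi x <= y - x.
Proof.
move=> xy; have := derive_bounded_lipschitz is_derive_Phi _ y x.
move=> /(_ 1); rewrite mul1r [leRHS]ger0_norm ?subr_ge0// => H.
apply: le_trans (ler_norm _) (H _) => t.
by rewrite gtr0_norm ?phi_gt0// phi_le1.
Qed.

Lemma Phi_le1 x : Phi x <= 1.
Proof.
rewrite -(@Rintegral_phi R) -(Rintegral_halflines x (integrable_phi measurableT)).
by rewrite PhiE lerDl Rintegral_ge0// => t _; exact/ltW/phi_gt0.
Qed.

(** A test function that is small on the right of [x] has a Gaussian mean not
    much above [Phi x], and one that is close to [1] on the left of [x] has a
    mean not much below it. *)
Lemma gauss_mean_le (h : R -> R) x eps : continuous h ->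
  (forall t, `|h t| <= 1) -> (forall t, x <= t -> h t <= eps) -> 0 <= eps ->
  gauss_mean h <= Phi x + eps.
Proof.
move=> ch h1 heps eps0; rewrite /gauss_mean.
rewrite -(Rintegral_halflines x (integrable_Mphi measurableT ch h1)).
have mI b (y : itv_bound R) : measurable [set` Interval b y] by exact: measurable_itv.
apply: lerD.
  rewrite PhiE; apply: le_Rintegral => //.
  - exact: (integrable_Mphi _ ch h1).
  - exact: integrable_phi.
  - move=> t _; rewrite -[leRHS]mul1r ler_wpM2r ?(ltW (phi_gt0 _))//.
    exact: le_trans (ler_norm _) (h1 t).
apply: (@le_trans _ _ (\int[lebesgue_measure]_(t in `]x, +oo[) (eps * phi t))).
  apply: le_Rintegral => //.
  - exact: (integrable_Mphi _ ch h1).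
  - apply: (@integrable_Mphi _ (fun=> eps) `|eps|) => //; exact: cst_continuous.
  - move=> t /=; rewrite in_itv/= andbT => xt.
    by rewrite ler_wpM2r ?(ltW (phi_gt0 _))// heps// ltW.
rewrite RintegralZl//; last exact: integrable_phi.
rewrite -[leRHS]mulr1 ler_wpM2l// -(@Rintegral_phi R).
rewrite -(Rintegral_halflines x (integrable_phi measurableT)) lerDr.
by rewrite Rintegral_ge0// => t _; exact/ltW/phi_gt0.
Qed.

Lemma gauss_mean_ge (h : R -> R) x eps : continuous h ->
  (forall t, `|h t| <= 1) -> (forall t, 0 <= h t) ->
  (forall t, t <= x -> 1 - eps <= h t) -> 0 <= eps ->
  Phi x - eps <= gauss_mean h.
Proof.
move=> ch h1 h0 heps eps0; rewrite /gauss_mean.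
rewrite -(Rintegral_halflines x (integrable_Mphi measurableT ch h1)).
rewrite -[leLHS]addr0; apply: lerD; last first.
  by apply: Rintegral_ge0 => t _; rewrite mulr_ge0// ltW// phi_gt0.
apply: (@le_trans _ _ (\int[lebesgue_measure]_(t in `]-oo, x]) ((1 - eps) * phi t))).
  rewrite RintegralZl//; last exact: integrable_phi.
  rewrite -PhiE mulrBl mul1r lerD2l lerN2 -[leRHS]mulr1 ler_wpM2l//.
  exact: Phi_le1.
apply: le_Rintegral => //.
- apply: (@integrable_Mphi _ (fun=> 1 - eps) `|1 - eps|) => //; exact: cst_continuous.
- exact: (integrable_Mphi _ ch h1).
- move=> t /=; rewrite in_itv/= => xt.
  by rewrite ler_wpM2r ?(ltW (phi_gt0 _))// heps.
Qed.

(** Kolmogorov distance from smooth test functions: a logistic function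
    centred at distance [eta] from [z] is, up to [eps], an indicator of a half
    line, except on an interval of length [2 * eta], whose Gaussian measure is
    at most [2 * eta]. *)
Lemma kolmogorov_from_logistic (d : measure_display) (T : measurableType d)
    (P : probability T R) (W : T -> R) (L kappa eta eps : R) :
  measurable_fun setT W -> 0 <= L -> 0 <= eta -> expR (- (L * eta)) <= eps ->
  (forall m, `|\int[P]_w logistic L m (W w) - gauss_mean (logistic L m)| <= kappa) ->
  forall z, `|fine (P [set w | W w <= z]) - Phi z| <= kappa + 2 * eps + 2 * eta.
Proof.
move=> mW L0 eta0 Leta Wkappa z.
have eps0 : 0 <= eps by exact: le_trans (expR_ge0 _) Leta.
have ch m : continuous (logistic L m).
  exact: derive_continuous (is_derive_logistic L m).
have mE : measurable [set w | W w <= z].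
  have := mW measurableT _ (measurable_itv `]-oo, z]).
  by rewrite setTI; congr measurable; apply/seteqP; split => w /=; rewrite in_itv.
have PE : fine (P [set w | W w <= z]) = \int[P]_w \1_[set w | W w <= z] w.
  by rewrite /Rintegral integral_indic// setIT.
have ih m : P.-integrable setT (EFin \o (fun w => logistic L m (W w))).
  apply: (@bounded_integrable _ _ _ _ _ 1) => [|w]; last exact: logistic_norm_le1.
  by apply: measurableT_comp mW; exact: continuous_measurable_fun.
have iE : P.-integrable setT (EFin \o (fun w => \1_[set w | W w <= z] w : R)).
  apply: (@bounded_integrable _ _ _ _ _ 1) => [|w]; first exact: measurable_indic.
  by rewrite indicE; case: (_ \in _); rewrite ?normr1 ?normr0.
have ieps : P.-integrable setT (EFin \o (fun=> eps)).
  by apply: (@bounded_integrable _ _ _ _ _ eps) => // w; rewrite ger0_norm.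
have indE w : \1_[set w | W w <= z] w = (W w <= z)%R%:R :> R.
  by rewrite indicE mem_setE.
have addeps g : P.-integrable setT (EFin \o g) ->
    \int[P]_w (g w + eps) = \int[P]_w g w + eps.
  by move=> ig; rewrite RintegralD// Rintegral_probability_cst.
rewrite ler_norml; apply/andP; split.
- have lowP : \int[P]_w logistic L (z - eta) (W w) - eps <= fine (P [set w | W w <= z]).
    rewrite PE lerBlDr -addeps//.
    apply: le_Rintegral => //; first exact: integrable_fun_add.
    move=> w _; rewrite indE; have [Wz|zW] := leP (W w) z.
      by rewrite (le_trans (ltW (logistic_lt1 _ _ _)))// lerDl.
    rewrite add0r; apply: le_trans Leta; apply: logistic_le => //; lra.
  have gm : Phi (z - 2 * eta) - eps <= gauss_mean (logistic L (z - eta)).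
    apply: gauss_mean_ge => //.
    + exact: logistic_norm_le1.
    + by move=> t; exact/ltW/logistic_gt0.
    + move=> t tz; apply: le_trans (logistic_ge (eta := eta) L0 _); [lra|lra].
  have zz : z - 2 * eta <= z by lra.
  have := Phi_lipschitz zz.
  have := Wkappa (z - eta); rewrite ler_norml => /andP[]; lra.
- have upP : fine (P [set w | W w <= z]) <= \int[P]_w logistic L (z + eta) (W w) + eps.
    rewrite PE -addeps//.
    apply: le_Rintegral => //; first exact: integrable_fun_add.
    move=> w _; rewrite indE; have [Wz|zW] := leP (W w) z; last first.
      by rewrite addr_ge0// ltW// logistic_gt0.
    have : 1 - expR (- (L * eta)) <= logistic L (z + eta) (W w).
      by apply: logistic_ge => //; lra.
    by move: Leta; rewrite -[true%:R]/(1 : R); lra.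
  have gm : gauss_mean (logistic L (z + eta)) <= Phi (z + 2 * eta) + eps.
    apply: gauss_mean_le => //.
    + exact: logistic_norm_le1.
    + by move=> t tz; apply: le_trans Leta; apply: logistic_le => //; lra.
  have zz : z <= z + 2 * eta by lra.
  have := Phi_lipschitz zz.
  have := Wkappa (z + eta); rewrite ler_norml => /andP[]; lra.
Qed.

End Smoothing.

(** * Mean square approximation of the field sums *)

Section L2Approximation.
Context {d : measure_display} {T : measurableType d} {R : realType}.
Variable P : probability T R.

Lemma cvge0_near_lt (U : Type) (F : set_system U) (u : U -> \bar R) (t : R) :
  Filter F -> u x @[x --> F] --> 0%E -> 0 < t -> \forall x \near F, (u x < t%:E)%E.
Proof.
move=> FF u0 t0.
exact: (u0 _ (@nbhs_open_ereal_lt R 0 (fun=> t) t0)).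
Qed.

(** A mean square bound gives a first absolute moment bound, through
    [`|x| <= (x ^+ 2 / t + t) / 2]. *)
Lemma Lnorm2_mean_abs (D : T -> R) (t : R) : measurable_fun setT D -> 0 < t ->
  (Lnorm P 2%:E (EFin \o D) < t%:E)%E ->
  P.-integrable setT (EFin \o D) /\ \int[P]_w `|D w| <= t.
Proof.
move=> mD t0 Dt.
have sqE : (\int[P]_w ((D w) ^+ 2)%:E < (t ^+ 2)%:E)%E.
  have n20 : (2 : R) != 0 by [].
  have := poweR_Lnorm P (EFin \o D) n20.
  under [X in _ = X -> _]eq_integral => w _ do
    rewrite /= powR_mulrn// real_normK ?num_real//.
  move=> <-; move: Dt (Lnorm_ge0 P 2%:E (EFin \o D)).
  case: (Lnorm _ _ _) => [l| |]//; rewrite lte_fin lee_fin => lt l0.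
  by rewrite poweR_EFin powR_mulrn// lte_fin ltr_pXn2r ?nnegrE// ltW.
have iD2 : P.-integrable setT (EFin \o (fun w => D w ^+ 2)).
  apply/integrableP; split.
    by apply/measurable_EFinP; exact: measurable_funX.
  under eq_integral do rewrite /= ger0_norm ?sqr_ge0//.
  exact: lt_trans sqE (ltry _).
pose B w := t^-1 / 2 * D w ^+ 2 + t / 2.
have it : P.-integrable setT (EFin \o (fun=> t / 2)).
  by apply: (@bounded_integrable _ _ _ _ _ `|t / 2|).
have iB : P.-integrable setT (EFin \o B).
  by apply: integrable_fun_add => //; exact: integrable_fun_scale.
have DB w : `|D w| <= B w.
  rewrite /B -(real_normK (num_real (D w))); set y := `|D w|.
  have := sqr_ge0 (y / t - 1) => H.
  have -> : y = t * (y / t) by field; rewrite gt_eqF.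
  set q := y / t in H *.
  have -> : t^-1 / 2 * (t * q) ^+ 2 = t * (q ^+ 2 / 2) by field; rewrite gt_eqF.
  by rewrite -mulrDr ler_wpM2l //; [exact: ltW|lra].
have iD : P.-integrable setT (EFin \o D).
  apply: le_integrable iB => //; first exact/measurable_EFinP.
  move=> w _; rewrite /= lee_fin (le_trans (DB w))//; exact: ler_norm.
split=> //.
apply: (@le_trans _ _ (\int[P]_w B w)).
  by apply: le_Rintegral => //; exact: integrable_norm.
rewrite /B RintegralD//; last exact: integrable_fun_scale.
rewrite Rintegral_probability_cst RintegralZl//.
have : \int[P]_w D w ^+ 2 <= t ^+ 2.
  rewrite -lee_fin /Rintegral fineK ?ltW//.
  exact: (integrable_fin_num measurableT iD2).
move=> H.
have : t^-1 / 2 * \int[P]_w D w ^+ 2 <= t^-1 / 2 * t ^+ 2.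
  by rewrite ler_wpM2l// mulr_ge0// invr_ge0 ltW.
have -> : t^-1 / 2 * t ^+ 2 = t / 2 by field; rewrite gt_eqF.
lra.
Qed.

End L2Approximation.

Section FieldApproximation.
Context {d : measure_display} {T : measurableType d} {R : realType}.
Variables (P : probability T R) (a : Z2 -> R) (xi X : Z2 -> {RV P >-> R}).
Hypothesis X_field : linear_random_field a xi X.

Let totally := @summability.totally Z2.

Let totally_proper : ProperFilter totally := summability.totally_filter.

(** The partial sums over [B] of the field at [x], after the change of index
    [q = p - x]: with this indexing the innovations [xi (- q)] are the same for
    all [x], so one set [B] serves for all points of [Gamma]. *)
Lemma field_approx x (t : R) : 0 < t -> \forall B \near totally,
  (Lnorm P 2%:E (fun w =>
    (X x w - \sum_(q <- (B : {fset Z2})) a (x + q) * xi (- q) w)%:E) < t%:E)%E.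
Proof.
move=> t0; have FF : Filter totally by exact: filter_filter.
have [A0 _ hA0] := cvge0_near_lt FF (@X_field x) t0.
exists [fset (p - x)%R | p in A0]%fset => // B /= BA0.
pose A := [fset (x + q)%R | q in B]%fset.
have AA0 : (A0 `<=` A)%fset.
  apply/fsubsetP => p pA0; apply/imfsetP; exists (p - x); last by rewrite addrC subrK.
  by apply: (fsubsetP BA0); apply/imfsetP; exists p.
have := hA0 A AA0; rewrite /=.
congr (Lnorm _ _ _ < _)%E; apply/funext => w; congr (_ - _)%:E.
rewrite big_imfset/=; last by move=> q q' _ _ /addrI.
by apply: eq_bigr => q _; rewrite opprD addrA subrr add0r.
Qed.

Lemma sum_field_approx (Gamma : {fset Z2}) (t : R) : 0 < t ->
  \forall B \near totally,
    let D w := \sum_(x <- Gamma) X x w -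
               \sum_(q <- (B : {fset Z2})) b_coef a Gamma q * xi (- q) w in
    P.-integrable setT (EFin \o D) /\
    \int[P]_w `|D w| <= (size Gamma)%:R * t.
Proof.
move=> t0; have FF : Filter totally by exact: filter_filter.
pose good (s : seq Z2) (B : {fset Z2}) := forall x, x \in s ->
  (Lnorm P 2%:E (fun w => (X x w - \sum_(q <- B) a (x + q) * xi (- q) w)%:E)
    < t%:E)%E.
have : \forall B \near totally, good Gamma B.
  elim: (Gamma : seq Z2) => [|x s IHs]; first exact: nearW.
  apply: (@filterS _ totally FF _ _ _ (filterI (field_approx x t0) IHs)).
  move=> B [Bx Bs] y.
  by rewrite inE => /orP[/eqP ->|/Bs].
apply: (@filterS _ totally FF) => B goodB.
pose D w := \sum_(x <- Gamma) X x w - \sum_(q <- B) b_coef a Gamma q * xi (- q) w.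
change (P.-integrable setT (EFin \o D) /\
  \int[P]_w `|D w| <= (size Gamma)%:R * t).
pose Dx x w := X x w - \sum_(q <- B) a (x + q) * xi (- q) w.
have mDx x : measurable_fun setT (Dx x).
  apply: measurable_funB; first exact: measurable_funPT.
  apply: (@measurable_sum _ _ _ _ _ _ (fun q w => a (x + q) * xi (- q) w)) => q.
  by apply: measurable_funM => //; exact: measurable_funPT.
have DE w : D w = \sum_(x <- Gamma) Dx x w.
  rewrite /D /Dx sumrB; congr (_ - _); rewrite exchange_big/=.
  by apply: eq_bigr => q _; rewrite /b_coef mulr_suml.
(* Outside [Gamma] nothing is known of [Dx]; setting it to [0] there makes the
   bounds unconditional, as the lemmas on sums require. *)
pose Dx' x := if x \in Gamma then Dx x else cst 0.
have Dx'P x : P.-integrable setT (EFin \o Dx' x) /\ \int[P]_w `|Dx' x w| <= t.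
  rewrite /Dx'; have [xG|_] := boolP (x \in Gamma).
    exact: Lnorm2_mean_abs (mDx x) t0 (goodB x xG).
  split; first by apply: (@bounded_integrable _ _ _ _ _ 0) => // w; rewrite normr0.
  under eq_Rintegral do rewrite /= normr0.
  by rewrite Rintegral_probability_cst ltW.
have {}DE : D = fun w => \sum_(x <- Gamma) Dx' x w.
  apply/funext => w; rewrite DE; apply: eq_big_seq => x xG.
  by rewrite /Dx' xG.
have iD : P.-integrable setT (EFin \o D).
  by rewrite DE; apply: integrable_fun_sum => x; case: (Dx'P x).
have iDx' x : P.-integrable setT (EFin \o (fun w => `|Dx' x w|)).
  by apply: integrable_norm; case: (Dx'P x).
split=> //.
apply: (@le_trans _ _ (\int[P]_w \sum_(x <- Gamma) `|Dx' x w|)).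
  apply: le_Rintegral => //.
  - exact: integrable_norm.
  - exact: integrable_fun_sum.
  - by move=> w _; rewrite DE ler_norm_sum.
rewrite Rintegral_sum//; apply: (@le_trans _ _ (\sum_(x <- Gamma) t)).
  by apply: ler_sum => x _; case: (Dx'P x).
by rewrite big_const_seq count_predT iter_addr addr0 mulr_natl.
Qed.

End FieldApproximation.

Section Variance.
Context {R : realType}.
Variables (a : Z2 -> R) (Gamma : {fset Z2}).
Hypothesis sigma0 : 0 < sigma a Gamma.

Let b := b_coef a Gamma.
Let E := (\esum_(p in [set: Z2]) ((b p) ^+ 2)%:E)%E.

(* The sum is finite because [fine] sends [+oo] to [0] and [sigma] is positive. *)
Let Efin : E = ((sigma a Gamma) ^+ 2)%:E.
Proof.
have fE0 : 0 < fine E by have := sigma0; rewrite /sigma sqrtr_gt0.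
rewrite /sigma sqr_sqrtr ?ltW//.
by move: fE0; rewrite -/b -/E; case: E => //=; rewrite ltxx.
Qed.

Lemma sum_sqr_b_coef_le (B : {fset Z2}) : \sum_(p <- B) b p ^+ 2 <= sigma a Gamma ^+ 2.
Proof.
rewrite -lee_fin -Efin; apply: esum_ge; exists [set` B]; first by split.
by rewrite fsbig_finite//= set_fsetK sumEFin.
Qed.

Lemma norm_b_coef_le p : `|b p| <= sigma a Gamma.
Proof.
rewrite -ler_sqr ?nnegrE ?(ltW sigma0)// real_normK ?num_real//.
by have := sum_sqr_b_coef_le [fset p]%fset; rewrite big_seq_fset1.
Qed.

Lemma normalized_b_coef_le p (delta : R) : rho a Gamma <= delta ->
  `|b p / sigma a Gamma| <= delta.
Proof.
move=> rhodelta; rewrite normrM normfV (gtr0_norm sigma0).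
apply: le_trans rhodelta; apply: ub_le_sup; last by exists p.
exists 1 => _ [q _ <-]; rewrite ler_pdivrMr// mul1r; exact: norm_b_coef_le.
Qed.

Lemma sum_sqr_normalized_b_coef_le1 (B : {fset Z2}) :
  \sum_(p <- B) (b p / sigma a Gamma) ^+ 2 <= 1.
Proof.
under eq_bigr do rewrite exprMn.
by rewrite -mulr_suml exprVn ler_pdivrMr ?mul1r ?sum_sqr_b_coef_le// exprn_gt0.
Qed.

Lemma sum_sqr_normalized_b_coef_near (eta : R) : 0 < eta ->
  \forall B \near @summability.totally Z2,
    1 - eta <= \sum_(p <- (B : {fset Z2})) (b p / sigma a Gamma) ^+ 2.
Proof.
move=> eta0; have s20 : 0 < sigma a Gamma ^+ 2 by rewrite exprn_gt0.
have [_ [A [finA _] <-] EA] : exists2 y : \bar R,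
    [set (\sum_(p \in A) ((b p) ^+ 2)%:E)%E | A in fsets [set: Z2]] y &
    (((1 - eta) * sigma a Gamma ^+ 2)%:E < y)%E.
  apply: ereal_sup_gt; rewrite -/E.
  rewrite [ltRHS]Efin lte_fin gtr_pMl//; lra.
exists (fset_set A) => // B /= AB.
move: EA; rewrite fsbig_finite// sumEFin lte_fin => EA.
under eq_bigr do rewrite exprMn.
rewrite -mulr_suml exprVn ler_pdivlMr//; apply: (le_trans (ltW EA)).
rewrite -lee_fin -!sumEFin; apply: lee_sum_nneg_subfset; first exact/fsubsetP.
by move=> p _ _; rewrite lee_fin sqr_ge0.
Qed.

End Variance.

(** * The uniform central limit theorem *)

(** The error of the mean square approximation can be made arbitrarily small,
    so the bound for the field is the bound of [stein_sum] for finite sums of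
    total variance [1]. *)
Lemma linear_field_smooth_clt (R : realType) (L M trunc tau delta : R)
    (h dh f df : R -> R)
    (F : distribution_function R) (a : Z2 -> R) (Gamma : {fset Z2})
    (d : measure_display) (T : measurableType d) (P : probability T R)
    (xi X : Z2 -> {RV P >-> R}) :
  (\int[lebesgue_stieltjes_measure F]_x x%:E = 0)%E ->
  (\int[lebesgue_stieltjes_measure F]_x (x ^+ 2)%:E = 1)%E ->
  0 <= trunc ->
  (\int[lebesgue_stieltjes_measure F]_(x in [set x : R | (trunc < `|x|)%R])
     (x ^+ 2)%:E <= tau%:E)%E ->
  0 < sigma a Gamma -> rho a Gamma <= delta ->
  iid xi F -> linear_random_field a xi X ->
  (forall t : R, is_derive t 1 h (dh t)) -> (forall t, `|h t| <= 1) ->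
  (forall t, `|dh t| <= L) ->
  (forall t : R, is_derive t 1 f (df t)) -> (forall t, `|f t| <= M) ->
  (forall t, `|df t| <= M) -> (forall s t, `|df s - df t| <= M * `|s - t|) ->
  (forall t, df t - t * f t = h t - gauss_mean h) ->
  `|\int[P]_w h ((\sum_(x <- Gamma) X x w) / sigma a Gamma) - gauss_mean h| <=
    M * (2 * tau + delta * trunc + delta).
Proof.
move=> mean0 var1 trunc0 tail sigma0 rhod xi_iid field dhP h1 dhL fP fM dfM dfL eqn.
set K := 2 * tau + delta * trunc + delta.
set s := sigma a Gamma in sigma0 *.
have M0 : 0 <= M by exact: le_trans (fM 0).
have L0 : 0 <= L by exact: le_trans (dhL 0).
apply/ler_addgt0Pr => e e0.
(* The finite set [B] is taken large enough for both approximation errors. *)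
pose eta := e / (M + L / s * (size Gamma)%:R + 1).
have den0 : 0 < M + L / s * (size Gamma)%:R + 1.
  by rewrite ltr_wpDl// addr_ge0// !mulr_ge0 ?invr_ge0// ltW.
have eta0 : 0 < eta by rewrite divr_gt0.
have etaE : M * eta + L / s * ((size Gamma)%:R * eta) <= e.
  have -> : M * eta + L / s * ((size Gamma)%:R * eta) =
      eta * (M + L / s * (size Gamma)%:R) by ring.
  have -> : e = eta * (M + L / s * (size Gamma)%:R + 1) by rewrite divfK// gt_eqF.
  by rewrite ler_pM2l// lerDl.
have FF := @summability.totally_filter Z2.
have [B [[iD ED] EB]] := @filter_ex _ _ FF _ (@filterI _ _ (@filter_filter _ _ FF)
  _ _ (sum_field_approx field Gamma eta0) (sum_sqr_normalized_b_coef_near sigma0 eta0)).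
have EB1 := sum_sqr_normalized_b_coef_le1 sigma0 B.
set D := (fun w => _ - _) in iD ED.
(* [stein_sum] is applied with the family [xi] indexed by [p = - q]. *)
pose J := [fset - q | q in B]%fset.
pose c (p : Z2) := b_coef a Gamma (- p) / s.
have reindex (g : Z2 -> R) : \sum_(p <- J) g (- p) = \sum_(q <- B) g q.
  rewrite big_imfset/=; last by move=> q q' _ _ /oppr_inj.
  by apply: eq_bigr => q _; rewrite opprK.
pose V w := \sum_(p <- J) c p * xi p w.
have cdelta p : p \in J -> `|c p| <= delta.
  by move=> _; exact: normalized_b_coef_le.
have cE : \sum_(p <- J) c p ^+ 2 = \sum_(q <- B) (b_coef a Gamma q / s) ^+ 2.
  by rewrite -(reindex (fun q => (b_coef a Gamma q / s) ^+ 2)).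
have VE w : V w = (\sum_(q <- B) b_coef a Gamma q * xi (- q) w) / s.
  rewrite mulr_suml -(reindex (fun q => b_coef a Gamma q * xi (- q) w / s)).
  by apply: eq_bigr => p _; rewrite opprK mulrAC.
have mxi p : measurable_fun setT (xi p : T -> R) by exact: measurable_funPT.
have mX x : measurable_fun setT (X x : T -> R) by exact: measurable_funPT.
have mV : measurable_fun setT V.
  apply: (@measurable_sum _ _ _ _ _ _ (fun p w => c p * xi p w)) => p.
  exact: measurable_funM.
pose W w := (\sum_(x <- Gamma) X x w) / s.
have mW : measurable_fun setT W.
  by apply: measurable_funM => //; apply: measurable_sum => x; exact: mX.
have mh : measurable_fun setT h.
  by apply: continuous_measurable_fun; exact: derive_continuous dhP.
have ih (Y : T -> R) : measurable_fun setT Y ->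
    P.-integrable setT (EFin \o (fun w => h (Y w))).
  move=> mY; apply: (@bounded_integrable _ _ _ _ _ 1) => //.
  exact: measurableT_comp mh mY.
have ihW := ih W mW; have ihV := ih V mV.
have WV : `|\int[P]_w h (W w) - \int[P]_w h (V w)| <= L / s * ((size Gamma)%:R * eta).
  rewrite -RintegralB//.
  apply: (@le_trans _ _ (\int[P]_w (L / s * `|D w|))).
    apply: ler_norm_Rintegral.
    - exact: integrable_fun_sub.
    - by apply: integrable_fun_scale; exact: integrable_norm.
    - move=> w; apply: le_trans (derive_bounded_lipschitz dhP dhL _ _) _.
      rewrite VE /W -mulrBl normrM normfV (gtr0_norm sigma0) -/(D w).
      by rewrite mulrCA mulrC mulrAC.
  rewrite RintegralZl//; last exact: integrable_norm.
  by rewrite ler_wpM2l// divr_ge0// ltW.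
have VN : `|\int[P]_w h (V w) - gauss_mean h| <= M * (eta + K).
  have -> : \int[P]_w h (V w) - gauss_mean h = \int[P]_w (df (V w) - V w * f (V w)).
    under [RHS]eq_Rintegral do rewrite eqn.
    rewrite RintegralB// ?Rintegral_probability_cst//.
    exact: (@bounded_integrable _ _ _ _ _ `|gauss_mean h|).
  apply: (le_trans (stein_sum xi_iid mean0 var1 trunc0 tail cdelta fP fM dfM dfL)).
  rewrite ler_wpM2l// cE -/K; apply: lerD.
    by rewrite ger0_norm ?subr_ge0// lerBlDr addrC -lerBlDr.
  rewrite ler_piMl//.
  have tau0 : 0 <= tau.
    rewrite -lee_fin; apply: le_trans tail; apply: integral_ge0 => x _.
    by rewrite lee_fin sqr_ge0.
  have delta0 : 0 <= delta by apply: le_trans (normalized_b_coef_le sigma0 0 rhod).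
  by rewrite /K !addr_ge0// mulr_ge0.
have -> : \int[P]_w h (W w) - gauss_mean h =
  (\int[P]_w h (W w) - \int[P]_w h (V w)) + (\int[P]_w h (V w) - gauss_mean h) by ring.
apply: (le_trans (ler_normD _ _)).
move: VN; rewrite mulrDr; lra.
Qed.

Theorem proposition1 (R : realType) (HH : set (distribution_function R))
  (mean0 : forall H, HH H ->
    (\int[lebesgue_stieltjes_measure H]_x x%:E = 0)%E)
  (var1 : forall H, HH H ->
    (\int[lebesgue_stieltjes_measure H]_x (x ^+ 2)%:E = 1)%E)
  (uniform_tails :
    ereal_sup [set (\int[lebesgue_stieltjes_measure H]_(x in [set x : R | (c < `|x|)%R])
                      (x ^+ 2)%:E)%E | H in HH] @[c --> +oo] --> 0%E) :
  forall eps : R, 0 < eps ->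
  exists2 delta : R, 0 < delta &
    forall (F : distribution_function R) (a : Z2 -> R) (Gamma : {fset Z2}),
    HH F -> square_summable a -> 0 < sigma a Gamma -> rho a Gamma <= delta ->
    forall (d : measure_display) (T : measurableType d) (P : probability T R)
      (xi X : Z2 -> {RV P >-> R}),
    iid xi F -> linear_random_field a xi X ->
    sup (range (fun z : R => `|G X a Gamma z - Phi z|)) <= eps.
Proof.
move=> eps eps0.
pose eta := eps / 16.
have eta0 : 0 < eta by rewrite divr_gt0.
(* As [expR y >= 1 + y], this slope makes [expR (- (L * eta))] at most [eta]. *)
pose L := eta^-1 / eta.
have L0 : 0 < L by rewrite divr_gt0 ?invr_gt0.
have Leta : expR (- (L * eta)) <= eta.
  rewrite /L divfK ?gt_eqF// expRN -[leRHS]invrK lef_pV2 ?posrE ?expR_gt0 ?invr_gt0//.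
  by apply: le_trans (expR_ge1Dx _); rewrite lerDr.
have [M M0 steinM] := @stein_equation R L.
(* With [delta = tau / (trunc + 1)] below, the smooth bound is [M * (3 * tau)]. *)
pose tau := eps / (16 * (M + 1)).
have M1 : 0 < M + 1 by rewrite ltr_wpDl.
have tau0 : 0 < tau by rewrite divr_gt0// mulr_gt0.
have [trunc [trunc0 tails]] : exists trunc : R, 0 <= trunc /\
    (ereal_sup [set (\int[lebesgue_stieltjes_measure H]_(x in
      [set x : R | (trunc < `|x|)%R]) (x ^+ 2)%:E)%E | H in HH] < tau%:E)%E.
  apply: (@filter_ex _ (pinfty_nbhs R)); apply: filterI.
    exact: nbhs_pinfty_ge.
  exact: cvge0_near_lt uniform_tails tau0.
pose delta := tau / (trunc + 1).
have trunc1 : 0 < trunc + 1 by rewrite ltr_wpDl.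
exists delta; first by rewrite divr_gt0.
move=> F a Gamma HF _ sigma0 rhod d T P xi X xi_iid field.
have tail : (\int[lebesgue_stieltjes_measure F]_(x in
    [set x : R | (trunc < `|x|)%R]) (x ^+ 2)%:E <= tau%:E)%E.
  apply: le_trans (ltW tails); apply: ereal_sup_ubound; by exists F.
apply: ge_sup; first by exists `|G X a Gamma 0 - Phi 0|, 0.
move=> _ [z _ <-].
have mW : measurable_fun setT (fun w => (\sum_(x <- Gamma) X x w) / sigma a Gamma).
  apply: measurable_funM => //; apply: measurable_sum => x.
  exact: measurable_funPT.
apply: (le_trans (kolmogorov_from_logistic (kappa := eps / 2) mW (ltW L0)
  (ltW eta0) Leta _ z)); last by rewrite /eta; lra.
move=> m.
have [f [df [fP fM dfM dfL eqn]]] := steinM _ _ (is_derive_logistic L m)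
  (logistic_norm_le1 L m) (fun t => derive_logistic_le m t (ltW L0)).
apply: (le_trans (linear_field_smooth_clt (mean0 F HF) (var1 F HF) trunc0 tail sigma0 rhod
  xi_iid field (is_derive_logistic L m) (logistic_norm_le1 L m)
  (fun t => derive_logistic_le m t (ltW L0)) fP fM dfM dfL eqn)).
have -> : 2 * tau + delta * trunc + delta = 3 * tau.
  have : delta * (trunc + 1) = tau by rewrite divfK// gt_eqF.
  by rewrite mulrDr mulr1 -addrA => ->; ring.
have : (M + 1) * tau = eps / 16 by rewrite /tau; field; rewrite gt_eqF.
by lra.
Qed.
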